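(* Let $\mathcal{I}$ be a nowhere tall ideal on $\omega$. Then for every $\boldsymbol{a}\in\mathbb{Z}^\omega$ we have $\mathsf{H}_{\boldsymbol{a}}(\mathcal{I})=\mathbb{T}$ if and only if $\mathrm{supp}(\boldsymbol{a})\in\mathcal{I}$.
   Context: $\omega=\{0,1,2,\dots\}$; $\mathbb{T}=\mathbb{R}/\mathbb{Z}$; $\|x\|:=\min\{|x-z|:z\in\mathbb{Z}\}$. An ideal on $\omega$ is a family $\mathcal{I}\subseteq\mathcal{P}(\omega)$ closed under subsets and finite unions, containing all finite subsets of $\omega$, and with $\omega\notin\mathcal{I}$; $\mathcal{I}^+:=\mathcal{P}(\omega)\setminus\mathcal{I}$. $\mathcal{I}$ is nowhere tall if for every $A\in\mathcal{I}^+$ there is an infinite set $B\subseteq A$ such that $\mathcal{I}\restriction B=[B]^{<\omega}$, where $\mathcal{I}\restriction B:=\{C\cap B:C\in\mathcal{I}\}$ and $[B]^{<\omega}$ is the family of finite subsets of $B$. For $\boldsymbol{a}=(a_n:n\in\omega)\in\mathbb{Z}^\omega$, $\mathrm{supp}(\boldsymbol{a}):=\{n\in\omega:a_n\ne0\}$ and $\mathsf{H}_{\boldsymbol{a}}(\mathcal{I}):=\{x\in\mathbb{T}:\{n\in\omega:\|a_nx\|\ge\varepsilon\}\in\mathcal{I}\text{ for all }\varepsilon>0\}$. *)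

(* Defs.v *)
From HB Require Import structures.
From mathcomp Require Import all_boot all_order all_algebra.
From mathcomp Require Import generic_quotient ring_quotient.
From mathcomp Require Import boolp classical_sets functions cardinality reals.

Set Implicit Arguments.
Unset Strict Implicit.
Unset Printing Implicit Defensive.

Import Order.TTheory GRing.Theory Num.Theory Quotient.

Local Open Scope classical_set_scope.
Local Open Scope ring_scope.
Local Open Scope quotient_scope.

Definition ideal_on_omega (I : set (set nat)) : Prop :=
  [/\ forall A B, B `<=` A -> I A -> I B,
      forall A B, I A -> I B -> I (A `|` B),
      forall A, finite_set A -> I A
    & ~ I [set: nat]].

Definition positive (I : set (set nat)) : set (set nat) := ~` I.

Definition restriction (I : set (set nat)) (B : set nat) : set (set nat) :=
  [set C `&` B | C in I].

Definition finite_subsets (B : set nat) : set (set nat) :=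
  [set F | F `<=` B /\ finite_set F].

Definition nowhere_tall (I : set (set nat)) : Prop :=
  forall A, positive I A ->
    exists B, [/\ infinite_set B, B `<=` A & restriction I B = finite_subsets B].

(* The additive quotient R/Z. *)
Definition torus (R : realType) : Type :=
  {quot GRing.ZmodClosed.clone R Num.int_num_subdef _}.

HB.instance Definition _ (R : realType) := GRing.Zmodule.on (torus R).
HB.instance Definition _ (R : realType) := EqQuotient.on (torus R).

Definition dist_int (R : realType) (x : R) : R :=
  inf [set `|x - z%:~R| | z in [set: int]].

Definition torus_norm (R : realType) (x : torus R) : R := dist_int (repr x).

(* The infimum is attained, so that it is the min over z. *)
Lemma dist_int_min (R : realType) (x : R) :
  exists2 z : int, dist_int x = `|x - z%:~R| &
    forall y : int, `|x - z%:~R| <= `|x - y%:~R|.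
Proof.
have [z zmin] : exists z : int, forall y : int, `|x - z%:~R| <= `|x - y%:~R|.
  have /andP[fx xf] := floor_itv x; set f := Num.floor x in fx xf.
  have dl : `|x - f%:~R| = x - f%:~R by rewrite ger0_norm ?subr_ge0.
  have dr : `|x - (f + 1)%:~R| = (f + 1)%:~R - x.
    by rewrite distrC ger0_norm // subr_ge0 ltW.
  have far (y : int) :
      (`|x - f%:~R| <= `|x - y%:~R|) || (`|x - (f + 1)%:~R| <= `|x - y%:~R|).
    have [yf|fy] := leP y f.
      have yf' : y%:~R <= f%:~R :> R by rewrite ler_int.
      by rewrite dl (le_trans _ (ler_norm _)) // lerD2l lerN2.
    have fy' : (f + 1)%:~R <= y%:~R :> R by rewrite ler_int lezD1.
    by rewrite orbC dr distrC (le_trans _ (ler_norm _)) // lerD2r.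
  have [h|h] := leP `|x - f%:~R| `|x - (f + 1)%:~R|.
    by exists f => y; have /orP[//|] := far y; exact: le_trans.
  by exists (f + 1) => y; have /orP[|//] := far y; apply: le_trans; exact: ltW.
exists z => //; apply/eqP; rewrite eq_le; apply/andP; split.
  apply: ge_inf; last by exists z.
  by exists 0 => _ [y _ <-].
apply: lb_le_inf; first by exists `|x - z%:~R|, z.
by move=> _ [y _ <-].
Qed.

(* The norm does not depend on the representative. *)
Lemma torus_norm_pi (R : realType) (x : R) :
  torus_norm (\pi_(torus R) x) = dist_int x.
Proof.
have /intrP[m xm] : x - repr (\pi_(torus R) x) \is a Num.int.
  have := idealrBE (GRing.ZmodClosed.clone R Num.int_num_subdef _)
    x (repr (\pi_(torus R) x)).
  by rewrite reprK eqxx.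
rewrite /torus_norm /dist_int; congr inf; apply/seteqP.
have xE : x = repr (\pi_(torus R) x) + m%:~R by rewrite -xm addrC subrK.
set r := repr _ in xE *; split=> _ [z _ <-].
  by exists (z + m) => //; rewrite xE rmorphD /= opprD addrACA subrr addr0.
exists (z - m) => //.
by rewrite xE rmorphB /= opprB addrA.
Qed.

Lemma torus_piMz (R : realType) (x : R) (m : int) :
  (\pi_(torus R) x) *~ m = \pi_(torus R) (m%:~R * x).
Proof.
have piMn n (y : R) : (\pi_(torus R) y) *+ n = \pi_(torus R) (y *+ n).
  elim: n => [|n IHn]; first by rewrite !mulr0n piE.
  by rewrite !mulrS IHn piE.
rewrite mulrzl; case: m => n; first exact: piMn.
by rewrite !NegzE !mulrNz -!pmulrn piMn piE.
Qed.

Definition supp (a : nat -> int) : set nat := [set n | a n != 0].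

Definition H (R : realType) (a : nat -> int) (I : set (set nat)) :
    set (torus R) :=
  [set x | forall eps : R, 0 < eps ->
    I [set n | eps <= torus_norm (x *~ a n)]].

Arguments H R a I : clear implicits.

(* Main.v *)
Require Import Defs.
From mathcomp Require Import all_boot all_order all_algebra.
From mathcomp Require Import boolp classical_sets reals.
From mathcomp Require Import generic_quotient cardinality lra.

(** If [supp a] lies in the ideal, then so does every set
    [{n | eps <= ||a_n x||}], because the norm vanishes wherever [a_n = 0].

    Conversely, suppose that [supp a] is positive, and use nowhere tallness to
    pick an infinite [B] inside [supp a] on which the ideal only has finite
    traces.  A single point [x] of the torus with [eps <= ||a_n x||] for
    infinitely many [n] in [B] is then outside of [H_a(I)].  There are two
    ways to find it.
    - If [|a_n| <= M] on [B], take [x = 1/(2(M+1))]: the numbers [a_n x] are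
      non-zero, of absolute value between [x] and [1/2], so [x <= ||a_n x||]
      on the whole of [B].
    - If [a] is unbounded on [B], choose indices in [B] along which [|a_n|]
      grows at least fourfold at each step.  For such a lacunary sequence, a
      nested interval argument ([lacunary_far_from_int]) gives an [x] with
      [1/4 <= ||a_n x||] at all the chosen indices. *)

Import Order.TTheory GRing.Theory Num.Theory.

Local Open Scope classical_set_scope.
Local Open Scope ring_scope.
Local Open Scope quotient_scope.

(** * Distance to the nearest integer *)

Lemma dist_int0 (R : realType) : dist_int (0 : R) = 0.
Proof.
have [z -> zmin] := dist_int_min (0 : R).
by apply/eqP; rewrite eq_le normr_ge0 andbT (le_trans (zmin 0)) // subrr normr0.
Qed.

Lemma dist_int_ge (R : realType) (x e : R) (z : int) :
  z%:~R + e <= x -> x <= z%:~R + 1 - e -> e <= dist_int x.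
Proof.
move=> zex xze; have [y -> _] := dist_int_min x.
have [yz|zy] := leP y z.
  have yz' : y%:~R <= z%:~R :> R by rewrite ler_int.
  by rewrite (le_trans _ (ler_norm _)) //; lra.
have zy' : (z + 1)%:~R <= y%:~R :> R by rewrite ler_int lezD1.
rewrite rmorphD /= in zy'.
by rewrite distrC (le_trans _ (ler_norm _)) //; lra.
Qed.

Lemma dist_intN_le (R : realType) (x : R) : dist_int (- x) <= dist_int x.
Proof.
have [y -> _] := dist_int_min x; have [z -> zmin] := dist_int_min (- x).
by rewrite (le_trans (zmin (- y))) // rmorphN /= -opprD normrN.
Qed.

Lemma dist_intN (R : realType) (x : R) : dist_int (- x) = dist_int x.
Proof.
by apply/eqP; rewrite eq_le dist_intN_le -{1}[x]opprK dist_intN_le.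
Qed.

Lemma dist_int_normM (R : realType) (c x : R) :
  dist_int (`|c| * x) = dist_int (c * x).
Proof. by case: (ger0P c) => // _; rewrite mulNr dist_intN. Qed.

Lemma torus_norm_piMz (R : realType) (x : R) (m : int) :
  torus_norm ((\pi_(torus R) x) *~ m) = dist_int (`|m%:~R| * x).
Proof. by rewrite torus_piMz torus_norm_pi dist_int_normM. Qed.

(** * Points kept away from the integers by a lacunary sequence *)

(** The left end of the interval that multiplication by [m] maps onto
    [[z + 1/4, z + 3/4]], for the least integer [z >= m t]; the length of that
    interval is [1 / (2 m)]. *)
Definition next_far (R : realType) (m t : R) : R :=
  ((Num.ceil (m * t))%:~R + 4%:R^-1) / m.

Fixpoint far_left_end (R : realType) (m : nat -> R) (k : nat) : R :=
  if k is k'.+1 then next_far R (m k) (far_left_end R m k')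
  else next_far R (m 0%N) 0.

Lemma next_far_ge (R : realType) (m t : R) : 0 < m -> t <= next_far R m t.
Proof.
move=> m0; rewrite /next_far ler_pdivlMr // [t * m]mulrC.
by have := ceil_ge (m * t); lra.
Qed.

Lemma next_far_le (R : realType) (m t : R) :
  0 < m -> next_far R m t <= t + 5%:R / 4%:R / m.
Proof.
move=> m0; rewrite /next_far ler_pdivrMr // mulrDl divfK ?gt_eqF //.
by have := ceilB1_lt (m * t); rewrite rmorphB /= [t * m]mulrC; lra.
Qed.

(** The intervals of points at distance at least [1/4] from the integers after
    multiplication by [m k] recur with period [1 / m k], so one of them for
    [m k.+1] fits in the one chosen for [m k].  Starting from the left end of
    the latter, this takes a room of at most [(1 + 1/4 + 1/2) / m k.+1], and the
    length available is [1 / (2 m k)]: a growth factor [4] is enough. *)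
Lemma lacunary_far_from_int (R : realType) (m : nat -> R) :
  (forall k, 0 < m k) -> (forall k, 4%:R * m k <= m k.+1) ->
  exists x : R, forall k, 4%:R^-1 <= dist_int (m k * x).
Proof.
move=> m0 m4; set u := far_left_end R m.
(* The intervals are the [[u k, v k]], and [sup u] is a common point. *)
pose v k := u k + 2%:R^-1 / m k.
have u_le : {homo u : i j / (i <= j)%N >-> i <= j}.
  apply: homo_leq => // [? ? ?|k]; first exact: le_trans.
  exact: next_far_ge.
have v_le : {homo v : i j / (i <= j)%N >-> j <= i}.
  apply: homo_leq => // [? ? ? ba cb|k]; first exact: le_trans cb ba.
  have uS : u k.+1 <= u k + 5%:R / 4%:R / m k.+1 by exact: next_far_le.
  have im : 4%:R * (m k.+1)^-1 <= (m k)^-1.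
    by rewrite ler_pdivrMr // mulrC ler_pdivlMr.
  have im0 : 0 < (m k.+1)^-1 by rewrite invr_gt0.
  rewrite /v; move: uS im im0; move: (u k) (u k.+1) (m k)^-1 (m k.+1)^-1.
  by move=> *; lra.
have uv k : u k <= v k by rewrite lerDl divr_ge0 ?ltW // invr_gt0.
have uv2 i k : u i <= v k.
  have [ik|ki] := leqP i k; first exact: le_trans (u_le _ _ ik) (uv k).
  exact: le_trans (uv i) (v_le _ _ (ltnW ki)).
exists (sup (range u)) => k.
have ux : u k <= sup (range u).
  apply: sup_upper_bound; last by exists k.
  by split; [exists (u 0%N), 0%N | exists (v 0%N) => _ [i _ <-]].
have xv : sup (range u) <= v k.
  apply: ge_sup => [|_ [i _ <-]//].
  by exists (u 0%N), 0%N.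
have [z uz] : exists z : int, m k * u k = z%:~R + 4%:R^-1.
  by rewrite /u; case: k {ux xv} => [|k] /=;
    rewrite /next_far mulrC divfK ?gt_eqF //; eexists.
have vz : m k * v k = m k * u k + 2%:R^-1.
  by rewrite /v mulrDr [m k * (_ / _)]mulrC divfK ?gt_eqF.
rewrite -(ler_pM2l (m0 k)) in ux; rewrite -(ler_pM2l (m0 k)) in xv.
by apply: (@dist_int_ge _ _ _ z); lra.
Qed.

(** * Points where infinitely many terms stay away from zero *)

(** The point [1 / (2 (M + 1))] is so small that its multiples by the [a n]
    never get past [1/2], hence their norm is their absolute value. *)
Lemma bounded_far_point (R : realType) (a : nat -> int) (B : set nat)
    (M : nat) :
  B `<=` supp a -> (forall n, B n -> (`|a n| <= M)%N) ->
  exists2 e : R, 0 < e &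
    exists x : torus R, B `<=` [set n | e <= torus_norm (x *~ a n)].
Proof.
move=> Ba aM; pose e : R := (2%:R * M.+1%:R)^-1.
have e0 : 0 < e by rewrite invr_gt0 mulr_gt0 // ltr0n.
exists e => //; exists (\pi_(torus R) e) => n Bn /=.
have Me : M.+1%:R * e = 2%:R^-1.
  by rewrite /e invfM mulrCA divff ?mulr1 ?pnatr_eq0.
have a1 : 1 <= `|(a n)%:~R| :> R.
  by rewrite -intr_norm ler1z -gtz0_ge1 normr_gt0; exact: Ba.
have aM' : `|(a n)%:~R| <= M.+1%:R :> R.
  by rewrite -intr_norm -abszE -pmulrn ler_nat leqW ?aM.
have ae : e <= `|(a n)%:~R| * e by rewrite ler_peMl // ltW.
have ae2 : `|(a n)%:~R| * e <= 2%:R^-1 by rewrite -Me ler_pM2r.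
have e2 : e <= 2%:R^-1 by exact: le_trans ae2.
by rewrite torus_norm_piMz; apply: (@dist_int_ge _ _ _ 0);
  rewrite ?add0r //; lra.
Qed.

(** Indices [s k] of [B] with [|a (s k)|] growing at least fourfold are
    automatically distinct, so a point far from zero along them witnesses an
    infinite set. *)
Lemma unbounded_far_point (R : realType) (a : nat -> int) (B : set nat) :
  (forall M, exists2 n, B n & (M < `|a n|)%N) ->
  exists x : torus R,
    infinite_set ([set n | 4%:R^-1 <= torus_norm (x *~ a n)] `&` B).
Proof.
move=> unb; have [f Bf af] := all_sig2 (fun M => cid2 (unb M)).
pose fix s k := if k is k'.+1 then f (4 * `|a (s k')|)%N else f 0%N.
have Bs k : B (s k) by case: k => [|k]; exact: Bf.
have sS k : (4 * `|a (s k)| < `|a (s k.+1)|)%N by exact: af.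
have s_gt0 k : (0 < `|a (s k)|)%N.
  by case: k => [|k]; [exact: af | exact: leq_ltn_trans (sS k)].
pose m k : R := `|(a (s k))%:~R|.
have mE k : m k = `|a (s k)|%:R by rewrite /m -intr_norm -abszE -pmulrn.
have [||x mx] := @lacunary_far_from_int R m.
- by move=> k; rewrite mE ltr0n.
- by move=> k; rewrite !mE -natrM ler_nat ltnW.
exists (\pi_(torus R) x); apply: (@sub_infinite_set _ (range s)).
  by move=> _ [k _ <-]; split=> //=; rewrite torus_norm_piMz; exact: mx.
have as_lt : {homo (fun k => `|a (s k)|%N) : i j / (i < j)%N}.
  apply: homo_ltn => [? ? ?|k]; first exact: ltn_trans.
  by rewrite (leq_ltn_trans _ (sS k)) // leq_pmull.
have s_inj : injective s.
  by move=> i j sij; case: (ltngtP i j) => // /as_lt; rewrite sij ltnn.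
move=> fin; apply: infinite_nat.
apply: sub_finite_set (finite_preimage _ fin) => [k _|]; first by exists k.
by move=> i j _ _; exact: s_inj.
Qed.

(** * The two implications *)

Lemma full_H_of_supp (R : realType) (I : set (set nat)) (a : nat -> int) :
  ideal_on_omega I -> I (supp a) -> H R a I = [set: torus R].
Proof.
move=> [Isub _ _ _] Ia; apply/seteqP; split=> // x _ e e0.
apply: Isub Ia => n /= ex; apply/negP => /eqP an0; move: ex.
rewrite -[x]reprK torus_norm_piMz an0 normr0 mul0r dist_int0.
by rewrite leNgt e0.
Qed.

Lemma not_full_H (R : realType) (I : set (set nat)) (a : nat -> int) :
  nowhere_tall I -> ~ I (supp a) -> H R a I <> [set: torus R].
Proof.
move=> ntI /ntI[B [Binf Ba IB]] HT.
suff [e e0 [x]] : exists2 e : R, 0 < e & exists x : torus R,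
    infinite_set ([set n | e <= torus_norm (x *~ a n)] `&` B).
  have Hx : H R a I x by rewrite HT.
  have : restriction I B ([set n | e <= torus_norm (x *~ a n)] `&` B).
    by exists [set n | e <= torus_norm (x *~ a n)] => //; exact: Hx.
  by rewrite IB => -[].
have [[M aM]|a_unb] := pselect (exists M, forall n, B n -> (`|a n| <= M)%N).
  have [e e0 [x Bx]] := @bounded_far_point R a B M Ba aM.
  by exists e => //; exists x; rewrite setIidr.
exists 4%:R^-1; first by rewrite invr_gt0.
apply: unbounded_far_point => M; apply: contrapT => nM; apply: a_unb.
exists M => n Bn; rewrite leqNgt; apply/negP => Mn.
by apply: nM; exists n.
Qed.

Local Close Scope quotient_scope.
Local Close Scope ring_scope.

Theorem corollary2p23 (R : realType) (I : set (set nat))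
    (idealI : ideal_on_omega I) (ntI : nowhere_tall I) (a : nat -> int) :
  H R a I = [set: torus R] <-> I (supp a).
Proof.
split; last exact: full_H_of_supp.
by move=> HT; apply: contrapT => Ia; exact: not_full_H Ia HT.
Qed.
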